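(* Let $k$ be a field. For any group schemes $G$, $H$ over $k$, the subfunctor $\mathbf{Hom}_{\mathrm{gp}}(G,H)$ is closed in $\mathbf{Hom}(G,H)$.
   Context: Conventions: schemes are over the field $k$ and are assumed separated and locally of finite type; morphisms and products are over $k$. Group schemes are thus locally of finite type over $k$. $\mathbf{Hom}(G,H)$ is the contravariant functor from schemes to sets $S\mapsto\mathrm{Hom}(G\times S,H)$ (morphisms of schemes). $\mathbf{Hom}_{\mathrm{gp}}(G,H)$ is the subfunctor whose $S$-points are the $f:G\times S\to H$ with $f(g_1g_2,s)=f(g_1,s)f(g_2,s)$ identically on $G\times G\times S$. A subfunctor $\mathbf{F}\subset\mathbf{F}'$ is closed if for every scheme $S$ and every morphism $S\to\mathbf{F}'$, the fiber product $\mathbf{F}\times_{\mathbf{F}'}S$ is represented by a closed subscheme of $S$. *)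

(* Defs.v *)
From HB Require Import structures.
From mathcomp Require Import all_boot all_algebra.
From mathcomp Require Import boolp.

Set Implicit Arguments.
Unset Strict Implicit.
Unset Printing Implicit Defensive.

Import GRing.Theory.
Local Open Scope ring_scope.

(* Schemes over a field k are defined by their functors of points, following
   Demazure-Gabriel, "Groupes algebriques", I, par. 1: a k-scheme is a functor
   from commutative k-algebras to sets that is a Zariski sheaf and has an open
   cover by affine functors; morphisms are natural transformations. *)

(* [comAlgType k] excludes the zero algebra, which is needed here (the empty
   scheme is Spec 0, and a quotient R / I may vanish). *)
Record kalg (k : fieldType) := KAlg {
  kalg_ring :> comPzRingType;
  kalg_str : {rmorphism k -> kalg_ring}
}.

Record khom (k : fieldType) (A B : kalg k) := KHom {
  khom_fun :> {rmorphism A -> B};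
  khom_str : forall c : k, khom_fun (kalg_str A c) = kalg_str B c
}.

Lemma khom_ext (k : fieldType) (A B : kalg k) (f g : khom A B) :
  f =1 g -> f = g.
Proof.
case: f g => [[f [[fA] [fB]]] f_str] [[g [[gA] [gB]]] g_str] /= fg.
have {}fg : f = g by apply: funext.
subst g; rewrite (Prop_irrelevance gA fA) (Prop_irrelevance gB fB) in g_str *.
by rewrite (Prop_irrelevance g_str f_str).
Qed.

Definition khom_id (k : fieldType) (A : kalg k) : khom A A :=
  @KHom k A A idfun (fun=> erefl).

Lemma khom_comp_subproof (k : fieldType) (A B C : kalg k)
    (g : khom B C) (f : khom A B) (c : k) :
  (g \o f) (kalg_str A c) = kalg_str C c.
Proof. by rewrite /= !khom_str. Qed.

Definition khom_comp (k : fieldType) (A B C : kalg k)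
    (g : khom B C) (f : khom A B) : khom A C :=
  @KHom k A C (g \o f : {rmorphism A -> C}) (khom_comp_subproof g f).

Definition is_ideal (R : comPzRingType) (I : R -> Prop) : Prop :=
  [/\ I 0, forall a b, I a -> I b -> I (a + b)
    & forall a b, I b -> I (a * b)].

Definition generates_unit_ideal (R : comPzRingType) (S : R -> Prop) : Prop :=
  exists (n : nat) (s c : 'I_n -> R),
    (forall i, S (s i)) /\ \sum_(i < n) c i * s i = 1.

Definition is_field_alg (k : fieldType) (K : kalg k) : Prop :=
  (1 : K) <> 0 /\ forall a : K, a <> 0 -> exists b : K, a * b = 1.

Definition fin_gen_alg (k : fieldType) (A : kalg k) : Prop :=
  exists (n : nat) (x : 'I_n -> A),
    forall P : A -> Prop,
      (forall c, P (kalg_str A c)) -> (forall i, P (x i)) ->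
      (forall a b, P a -> P b -> P (a + b)) ->
      (forall a b, P a -> P b -> P (a * b)) ->
      forall a, P a.

(* l : A -> L identifies L with A[1/f]. *)
Definition is_localization (k : fieldType) (A L : kalg k) (f : A)
    (l : khom A L) : Prop :=
  [/\ exists u : L, l f * u = 1,
      forall a, l a = 0 -> exists n : nat, f ^+ n * a = 0
    & forall b : L, exists (n : nat) (a : A), b * l f ^+ n = l a].

Record kfunctor (k : fieldType) := KFunctor {
  kpts :> kalg k -> Type;
  kmap : forall A B : kalg k, khom A B -> kpts A -> kpts B;
  kmap_id : forall A (x : kpts A), kmap (khom_id A) x = x;
  kmap_comp : forall A B C (g : khom B C) (f : khom A B) (x : kpts A),
    kmap (khom_comp g f) x = kmap g (kmap f x)
}.
Arguments kmap {k} X {A B} h x : rename.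

Record kmor (k : fieldType) (X Y : kfunctor k) := KMor {
  kmor_fun :> forall A : kalg k, X A -> Y A;
  kmor_nat : forall (A B : kalg k) (h : khom A B) (x : X A),
    kmor_fun (kmap X h x) = kmap Y h (kmor_fun x)
}.
Arguments kmor_fun {k X Y} f A x : rename.

Lemma kmor_ext (k : fieldType) (X Y : kfunctor k) (f g : kmor X Y) :
  (forall A (x : X A), f A x = g A x) -> f = g.
Proof.
case: f g => [f fN] [g gN] /= fg.
have {}fg : f = g.
  by apply: functional_extensionality_dep => A; apply: funext => x; exact: fg.
by subst g; rewrite (Prop_irrelevance gN fN).
Qed.

Definition kmor_id (k : fieldType) (X : kfunctor k) : kmor X X :=
  @KMor k X X (fun A x => x) (fun _ _ _ _ => erefl).

Lemma kmor_comp_subproof (k : fieldType) (X Y Z : kfunctor k)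
    (g : kmor Y Z) (f : kmor X Y) (A B : kalg k) (h : khom A B) (x : X A) :
  g B (f B (kmap X h x)) = kmap Z h (g A (f A x)).
Proof. by rewrite !kmor_nat. Qed.

Definition kmor_comp (k : fieldType) (X Y Z : kfunctor k)
    (g : kmor Y Z) (f : kmor X Y) : kmor X Z :=
  @KMor k X Z (fun A x => g A (f A x)) (kmor_comp_subproof g f).

Definition kiso (k : fieldType) (X Y : kfunctor k) : Prop :=
  exists (f : kmor X Y) (g : kmor Y X),
    kmor_comp g f = kmor_id X /\ kmor_comp f g = kmor_id Y.

Definition Spec (k : fieldType) (A : kalg k) : kfunctor k.
Proof.
refine (@KFunctor k (fun B => khom A B)
  (fun B C (h : khom B C) (x : khom A B) => khom_comp h x) _ _).
- by move=> B x; apply: khom_ext.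
- by move=> B C D g f x; apply: khom_ext.
Defined.

(* The product over k; k-schemes are a full subcategory of k-functors stable
   under products, so this is also the product of k-schemes. *)
Definition kprod (k : fieldType) (X Y : kfunctor k) : kfunctor k.
Proof.
refine (@KFunctor k (fun A => (X A * Y A)%type)
  (fun A B h p => (kmap X h p.1, kmap Y h p.2)) _ _).
- by move=> A [x y]; rewrite !kmap_id.
- by move=> A B C g f [x y]; rewrite !kmap_comp.
Defined.

(* The final k-functor, that is, Spec k. *)
Definition kpoint (k : fieldType) : kfunctor k :=
  @KFunctor k (fun=> unit) (fun _ _ _ u => u)
    (fun _ _ => erefl) (fun _ _ _ _ _ _ => erefl).

Record ksub (k : fieldType) (X : kfunctor k) := KSub {
  ksub_mem :> forall A : kalg k, X A -> Prop;
  ksub_stable : forall (A B : kalg k) (h : khom A B) (x : X A),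
    ksub_mem x -> ksub_mem (kmap X h x)
}.
Arguments ksub_mem {k X} U A x : rename.

Definition ksub_fun (k : fieldType) (X : kfunctor k) (U : ksub X) : kfunctor k.
Proof.
refine (@KFunctor k (fun A => {x : X A | U A x})
  (fun A B h x => exist _ (kmap X h (sval x)) (ksub_stable h (svalP x))) _ _).
- by move=> A [x Ux]; apply: eq_exist; rewrite /= kmap_id.
- by move=> A B C g f [x Ux]; apply: eq_exist; rewrite /= kmap_comp.
Defined.

(* For every x : Spec A -> X, the inverse image of U in Spec A is the closed
   subscheme V(I) = Spec (A / I). *)
Definition is_closed_ksub (k : fieldType) (X : kfunctor k) (U : ksub X) :
    Prop :=
  forall (A : kalg k) (x : X A),
    exists I : A -> Prop, is_ideal I /\
      forall (B : kalg k) (h : khom A B),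
        U B (kmap X h x) <-> (forall a, I a -> h a = 0).

(* For every x : Spec A -> X, the inverse image of U in Spec A is the open
   subscheme D(I), the complement of V(I). *)
Definition is_open_ksub (k : fieldType) (X : kfunctor k) (U : ksub X) :
    Prop :=
  forall (A : kalg k) (x : X A),
    exists I : A -> Prop, is_ideal I /\
      forall (B : kalg k) (h : khom A B),
        U B (kmap X h x) <->
        generates_unit_ideal (fun b : B => exists a, I a /\ h a = b).

Definition kdiag (k : fieldType) (X : kfunctor k) : ksub (kprod X X).
Proof.
by refine (@KSub k (kprod X X) (fun A p => p.1 = p.2) _) => A B h x /= ->.
Defined.

Definition kimage (k : fieldType) (X Y : kfunctor k) (f : kmor X Y) : ksub Y.
Proof.
refine (@KSub k Y (fun A y => exists x : X A, f A x = y) _).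
by move=> A B h _ [x <-]; exists (kmap X h x); rewrite kmor_nat.
Defined.

(* The sheaf condition for the covers of Spec A by basic open sets D(f i). *)
Definition is_zariski_sheaf (k : fieldType) (X : kfunctor k) : Prop :=
  forall (A : kalg k) (n : nat) (f : 'I_n -> A),
  (exists c : 'I_n -> A, \sum_(i < n) c i * f i = 1) ->
  forall (L : 'I_n -> kalg k) (l : forall i, khom A (L i)),
  (forall i, is_localization (f i) (l i)) ->
  forall (M : 'I_n -> 'I_n -> kalg k) (m : forall i j, khom A (M i j)),
  (forall i j, is_localization (f i * f j) (m i j)) ->
  forall (p : forall i j, khom (L i) (M i j))
         (q : forall i j, khom (L j) (M i j)),
  (forall i j, khom_comp (p i j) (l i) = m i j) ->
  (forall i j, khom_comp (q i j) (l j) = m i j) ->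
  forall x : forall i, X (L i),
  (forall i j, kmap X (p i j) (x i) = kmap X (q i j) (x j)) ->
  exists! y : X A, forall i, kmap X (l i) y = x i.

(* X has an open cover by affine schemes Spec A with A satisfying P; open
   subfunctors cover X as soon as they do so on field-valued points. *)
Definition has_affine_cover (k : fieldType) (P : kalg k -> Prop)
    (X : kfunctor k) : Prop :=
  exists (J : Type) (U : J -> ksub X),
    [/\ forall j, is_open_ksub (U j),
        forall j, exists A : kalg k, P A /\ kiso (ksub_fun (U j)) (Spec A)
      & forall K : kalg k, is_field_alg K ->
          forall x : X K, exists j, U j K x].

Definition is_kscheme (k : fieldType) (X : kfunctor k) : Prop :=
  is_zariski_sheaf X /\ has_affine_cover (fun=> True) X.

Definition locally_of_finite_type (k : fieldType) (X : kfunctor k) : Prop :=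
  has_affine_cover (@fin_gen_alg k) X.

Definition separated (k : fieldType) (X : kfunctor k) : Prop :=
  is_closed_ksub (kdiag X).

Record scheme (k : fieldType) := Scheme {
  scheme_fun :> kfunctor k;
  scheme_is_kscheme : is_kscheme scheme_fun;
  scheme_lft : locally_of_finite_type scheme_fun;
  scheme_sep : separated scheme_fun
}.

Definition closed_immersion (k : fieldType) (Z S : scheme k) (i : kmor Z S) :
    Prop :=
  (forall A : kalg k, injective (fun z : Z A => i A z)) /\
  is_closed_ksub (kimage i).

Record group_scheme (k : fieldType) := GroupScheme {
  gs_scheme :> scheme k;
  gs_mul : kmor (kprod gs_scheme gs_scheme) gs_scheme;
  gs_one : kmor (kpoint k) gs_scheme;
  gs_inv : kmor gs_scheme gs_scheme;
  gs_mulA : forall (A : kalg k) (x y z : gs_scheme A),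
    gs_mul A (x, gs_mul A (y, z)) = gs_mul A (gs_mul A (x, y), z);
  gs_mul1 : forall (A : kalg k) (x : gs_scheme A),
    gs_mul A (gs_one A tt, x) = x /\ gs_mul A (x, gs_one A tt) = x;
  gs_mulV : forall (A : kalg k) (x : gs_scheme A),
    gs_mul A (gs_inv A x, x) = gs_one A tt /\
    gs_mul A (x, gs_inv A x) = gs_one A tt
}.

Record sch_functor (k : fieldType) := SchFunctor {
  sf_pts :> scheme k -> Type;
  sf_map : forall S T : scheme k, kmor T S -> sf_pts S -> sf_pts T;
  sf_map_id : forall (S : scheme k) (x : sf_pts S), sf_map (kmor_id S) x = x;
  sf_map_comp : forall (S T W : scheme k) (t : kmor T S) (w : kmor W T)
      (x : sf_pts S),
    sf_map (kmor_comp t w) x = sf_map w (sf_map t x)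
}.
Arguments sf_map {k} F {S T} t x : rename.

Record sch_nat (k : fieldType) (F F' : sch_functor k) := SchNat {
  sn_fun :> forall S : scheme k, F S -> F' S;
  sn_nat : forall (S T : scheme k) (t : kmor T S) (x : F S),
    sn_fun (sf_map F t x) = sf_map F' t (sn_fun x)
}.
Arguments sn_fun {k F F'} phi S x : rename.

Record sch_subfunctor (k : fieldType) (F : sch_functor k) := SchSubfunctor {
  ss_mem :> forall S : scheme k, F S -> Prop;
  ss_stable : forall (S T : scheme k) (t : kmor T S) (x : F S),
    ss_mem x -> ss_mem (sf_map F t x)
}.
Arguments ss_mem {k F} E S x : rename.

Definition yoneda (k : fieldType) (S : scheme k) : sch_functor k.
Proof.
refine (@SchFunctor k (fun T => kmor T S)
  (fun T T' (t : kmor T' T) (x : kmor T S) => kmor_comp x t) _ _).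
- by move=> T x; apply: kmor_ext.
- by move=> T T' T'' t w x; apply: kmor_ext.
Defined.

(* The fiber product E x_F S of a subfunctor E of F with phi : S -> F, as a
   subfunctor of S: its T-points are the t : T -> S with phi(t) in E(T). *)
Definition fiber_product (k : fieldType) (F : sch_functor k)
    (E : sch_subfunctor F) (S : scheme k) (phi : sch_nat (yoneda S) F) :
  sch_subfunctor (yoneda S).
Proof.
refine (@SchSubfunctor k (yoneda S) (fun T t => E T (phi T t)) _).
by move=> T T' t' t Et; rewrite sn_nat; apply: ss_stable.
Defined.

Definition represented_by (k : fieldType) (S : scheme k)
    (E : sch_subfunctor (yoneda S)) (Z : scheme k) (i : kmor Z S) : Prop :=
  forall (T : scheme k) (t : kmor T S),
    E T t <-> exists! u : kmor T Z, kmor_comp i u = t.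

Definition is_closed_subfunctor (k : fieldType) (F : sch_functor k)
    (E : sch_subfunctor F) : Prop :=
  forall (S : scheme k) (phi : sch_nat (yoneda S) F),
    exists (Z : scheme k) (i : kmor Z S),
      closed_immersion i /\ represented_by (fiber_product E phi) i.

Definition id_prod (k : fieldType) (G S T : kfunctor k) (t : kmor T S) :
  kmor (kprod G T) (kprod G S).
Proof.
refine (@KMor k (kprod G T) (kprod G S) (fun A p => (p.1, t A p.2)) _).
by move=> A B h [g s] /=; rewrite kmor_nat.
Defined.

Definition Hom (k : fieldType) (G H : scheme k) : sch_functor k.
Proof.
refine (@SchFunctor k (fun S => kmor (kprod G S) H)
  (fun S T t f => kmor_comp f (id_prod G t)) _ _).
- by move=> S f; apply: kmor_ext => A [g s].
- by move=> S T W t w f; apply: kmor_ext.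
Defined.

Definition Hom_gp (k : fieldType) (G H : group_scheme k) :
  sch_subfunctor (Hom G H).
Proof.
refine (@SchSubfunctor k (Hom G H) (fun S (f : kmor (kprod G S) H) =>
  forall (A : kalg k) (g1 g2 : G A) (s : S A),
    f A (gs_mul G A (g1, g2), s) =
    gs_mul H A (f A (g1, s), f A (g2, s))) _).
by move=> S T t f f_hom A g1 g2 s /=; rewrite f_hom.
Defined.

(* Main.v *)
Require Import Defs.
From mathcomp Require Import all_boot all_algebra.
From HB Require Import structures.
From mathcomp Require Import boolp classical_sets generic_quotient ring.

(* For f : G x S -> H, the T-points t : T -> S over which f is a homomorphism
   are those landing in the subfunctor Z of S of the s such that, for all g1, g2
   over any extension, (f(g1 g2, s), f(g1, s) f(g2, s)) lies on the diagonal of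
   H. The diagonal is closed, so it suffices that closed subfunctors P of G x Y
   are stable under "for all g in G". Locally g is a point of an affine open
   Spec D of G, and the universal such point lives in D (x) A for y in Y(A). As
   k is a field, an element of D (x) A is determined by its images in A under
   the linear forms v : D -> k; hence the equations of P over A / I vanish as
   soon as I contains all their "coordinates". *)

Set Implicit Arguments.
Unset Strict Implicit.
Unset Printing Implicit Defensive.

Import GRing.Theory.
Local Open Scope ring_scope.
Local Open Scope quotient_scope.

(** * Commutative rings presented by operations up to an equivalence *)

(** Common source of the algebras [A / I], [A[1/f]] and [D (x) A]: the ring laws hold on the carrier
    only up to [sr_eq]. Compatibility is asked in the left argument alone, as commutativity
    transports it to the right one. *)
Record setoid_ring := SetoidRing {
  sr_sort :> choiceType;
  sr_eq : sr_sort -> sr_sort -> Prop;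
  sr_zero : sr_sort;
  sr_one : sr_sort;
  sr_opp : sr_sort -> sr_sort;
  sr_add : sr_sort -> sr_sort -> sr_sort;
  sr_mul : sr_sort -> sr_sort -> sr_sort;
  sr_refl : forall x, sr_eq x x;
  sr_sym : forall x y, sr_eq x y -> sr_eq y x;
  sr_trans : forall x y z, sr_eq x y -> sr_eq y z -> sr_eq x z;
  sr_congN : forall x y, sr_eq x y -> sr_eq (sr_opp x) (sr_opp y);
  sr_congD : forall x y z, sr_eq x y -> sr_eq (sr_add x z) (sr_add y z);
  sr_congM : forall x y z, sr_eq x y -> sr_eq (sr_mul x z) (sr_mul y z);
  sr_addA : forall x y z,
    sr_eq (sr_add x (sr_add y z)) (sr_add (sr_add x y) z);
  sr_addC : forall x y, sr_eq (sr_add x y) (sr_add y x);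
  sr_add0 : forall x, sr_eq (sr_add sr_zero x) x;
  sr_addN : forall x, sr_eq (sr_add (sr_opp x) x) sr_zero;
  sr_mulA : forall x y z,
    sr_eq (sr_mul x (sr_mul y z)) (sr_mul (sr_mul x y) z);
  sr_mulC : forall x y, sr_eq (sr_mul x y) (sr_mul y x);
  sr_mul1 : forall x, sr_eq (sr_mul sr_one x) x;
  sr_mulDl : forall x y z,
    sr_eq (sr_mul (sr_add x y) z) (sr_add (sr_mul x z) (sr_mul y z))
}.

Section QuotientRing.
Variable X : setoid_ring.
Implicit Types x y : X.

Definition sr_rel : rel X := fun x y => `[< sr_eq x y >].

Lemma sr_rel_refl : reflexive sr_rel.
Proof. by move=> x; apply/asboolP; exact: sr_refl. Qed.

Lemma sr_rel_sym : symmetric sr_rel.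
Proof. by move=> x y; apply/asboolP/asboolP; exact: sr_sym. Qed.

Lemma sr_rel_trans : transitive sr_rel.
Proof.
by move=> y x z /asboolP xy /asboolP yz; apply/asboolP; exact: sr_trans yz.
Qed.

Canonical sr_equiv := EquivRel sr_rel sr_rel_refl sr_rel_sym sr_rel_trans.

Definition quot_ring : Type := {eq_quot sr_equiv}.
HB.instance Definition _ := Choice.on quot_ring.

Definition qpi (x : X) : quot_ring := \pi_{eq_quot sr_equiv} x.
Definition qrepr (q : quot_ring) : X := repr (q : {eq_quot sr_equiv}).

Lemma qreprK q : qpi (qrepr q) = q.
Proof. exact: reprK. Qed.

Lemma qpiP x y : qpi x = qpi y <-> sr_eq x y.
Proof.
by split=> [/(eqmodP sr_equiv x y)/asboolP //|xy]; apply/eqmodP/asboolP.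
Qed.

Lemma qrepr_pi x : sr_eq (qrepr (qpi x)) x.
Proof. by apply/qpiP; rewrite qreprK. Qed.

Let qadd (p q : quot_ring) := qpi (sr_add (qrepr p) (qrepr q)).
Let qmul (p q : quot_ring) := qpi (sr_mul (qrepr p) (qrepr q)).
Let qopp (p : quot_ring) := qpi (sr_opp (qrepr p)).

Let qaddE x y : qadd (qpi x) (qpi y) = qpi (sr_add x y).
Proof.
apply/qpiP; apply: sr_trans (sr_congD _ (qrepr_pi x)) _.
apply: sr_trans (sr_addC _ _) _; apply: sr_trans (sr_addC _ _).
exact: sr_congD (qrepr_pi y).
Qed.

Let qmulE x y : qmul (qpi x) (qpi y) = qpi (sr_mul x y).
Proof.
apply/qpiP; apply: sr_trans (sr_congM _ (qrepr_pi x)) _.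
apply: sr_trans (sr_mulC _ _) _; apply: sr_trans (sr_mulC _ _).
exact: sr_congM (qrepr_pi y).
Qed.

Let qoppE x : qopp (qpi x) = qpi (sr_opp x).
Proof. by apply/qpiP/sr_congN/qrepr_pi. Qed.

Let qaddA : associative qadd.
Proof.
move=> p q r; rewrite -(qreprK p) -(qreprK q) -(qreprK r) !qaddE.
exact/qpiP/sr_addA.
Qed.

Let qaddC : commutative qadd.
Proof. by move=> p q; exact/qpiP/sr_addC. Qed.

Let qadd0 : left_id (qpi (sr_zero X)) qadd.
Proof. by move=> p; rewrite -(qreprK p) qaddE; exact/qpiP/sr_add0. Qed.

Let qaddN : left_inverse (qpi (sr_zero X)) qopp qadd.
Proof. by move=> p; rewrite -(qreprK p) qoppE qaddE; exact/qpiP/sr_addN. Qed.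

HB.instance Definition _ :=
  GRing.isZmodule.Build quot_ring qaddA qaddC qadd0 qaddN.

Let qmulA : associative qmul.
Proof.
move=> p q r; rewrite -(qreprK p) -(qreprK q) -(qreprK r) !qmulE.
exact/qpiP/sr_mulA.
Qed.

Let qmulC : commutative qmul.
Proof. by move=> p q; exact/qpiP/sr_mulC. Qed.

Let qmul1 : left_id (qpi (sr_one X)) qmul.
Proof. by move=> p; rewrite -(qreprK p) qmulE; exact/qpiP/sr_mul1. Qed.

Let qmulDl : left_distributive qmul +%R.
Proof.
move=> p q r; rewrite -(qreprK p) -(qreprK q) -(qreprK r) /+%R /=.
by rewrite qaddE !qmulE qaddE; exact/qpiP/sr_mulDl.
Qed.

HB.instance Definition _ :=
  GRing.Zmodule_isComPzRing.Build quot_ring qmulA qmulC qmul1 qmulDl.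

Lemma qpi0 : qpi (sr_zero X) = 0. Proof. by []. Qed.
Lemma qpi1 : qpi (sr_one X) = 1. Proof. by []. Qed.
Lemma qpiD x y : qpi (sr_add x y) = qpi x + qpi y.
Proof. by rewrite -qaddE. Qed.
Lemma qpiM x y : qpi (sr_mul x y) = qpi x * qpi y.
Proof. by rewrite -qmulE. Qed.
Lemma qpi_eq0 x : qpi x = 0 <-> sr_eq x (sr_zero X).
Proof. exact: qpiP. Qed.
End QuotientRing.

(** * Quotients and localizations of [k]-algebras *)

Lemma rmorphism_of (R S : pzRingType) (f : R -> S) :
  {morph f : x y / x + y} -> {morph f : x y / x * y} -> f 1 = 1 ->
  {g : {rmorphism R -> S} | g =1 f}.
Proof.
move=> fD fM f1.
have fB : zmod_morphism f.
  move=> x y; apply/eqP; rewrite eq_sym subr_eq -fD subrK; exact/eqP.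
pose fB' := GRing.isZmodMorphism.Build _ _ f fB.
pose fM' := GRing.isMonoidMorphism.Build _ _ f (f1, fM).
pose g : {rmorphism R -> S} :=
  HB.pack_for {rmorphism R -> S} f fB' fM'.
by exists g.
Qed.

Section AlgebraConstructions.
Variable k : fieldType.
Implicit Types A B C D : kalg k.

(** Preservation of 1 follows from compatibility with the structure maps, which send 1 to 1. *)
Lemma khom_of (A B : kalg k) (f : A -> B) :
  {morph f : x y / x + y} -> {morph f : x y / x * y} ->
  (forall c, f (kalg_str A c) = kalg_str B c) -> {h : khom A B | h =1 f}.
Proof.
move=> fD fM fk.
have f1 : f 1 = 1 by rewrite -(rmorph1 (kalg_str A)) fk rmorph1.
have [g gf] := rmorphism_of fD fM f1.
have gk c : g (kalg_str A c) = kalg_str B c by rewrite gf.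
by exists (KHom gk).
Qed.

Lemma kalg_of_setoid (X : setoid_ring) (c : k -> X) :
  (forall x y, sr_eq (c (x + y)) (sr_add (c x) (c y))) ->
  (forall x y, sr_eq (c (x * y)) (sr_mul (c x) (c y))) ->
  sr_eq (c 1) (sr_one X) ->
  {s : {rmorphism k -> quot_ring X} | forall x, s x = qpi (c x)}.
Proof.
move=> cD cM c1; apply: rmorphism_of.
- by move=> x y; rewrite -qpiD; apply/qpiP.
- by move=> x y; rewrite -qpiM; apply/qpiP.
- by rewrite -qpi1; apply/qpiP.
Qed.

Lemma ideal_opp (R : comPzRingType) (I : R -> Prop) (a : R) :
  is_ideal I -> I a -> I (- a).
Proof. by case=> _ _ IM Ia; rewrite -mulN1r; exact: IM. Qed.

Lemma quotient_exists A (I : A -> Prop) : is_ideal I ->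
  exists (Q : kalg k) (p : khom A Q),
    (forall q, exists a, p a = q) /\ forall a, p a = 0 <-> I a.
Proof.
move=> Ii; have [I0 ID IM] := Ii.
have cl a b : I a -> a = b -> I b by move=> ? <-.
unshelve epose (X := @SetoidRing A (fun a b => I (a - b)) 0 1 -%R +%R *%R
  _ _ _ _ _ _ _ _ _ _ _ _ _ _).
all: cbv beta.
- by move=> x; rewrite subrr.
- by move=> x y Ixy; apply: cl (ideal_opp Ii Ixy) _; ring.
- by move=> x y z Ixy Iyz; apply: cl (ID _ _ Ixy Iyz) _; ring.
- by move=> x y Ixy; apply: cl (ideal_opp Ii Ixy) _; ring.
- by move=> x y z Ixy; apply: cl Ixy _; ring.
- by move=> x y z Ixy; apply: cl (IM z _ Ixy) _; ring.
- by move=> x y z; apply: cl I0 _; ring.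
- by move=> x y; apply: cl I0 _; ring.
- by move=> x; apply: cl I0 _; ring.
- by move=> x; apply: cl I0 _; ring.
- by move=> x y z; apply: cl I0 _; ring.
- by move=> x y; apply: cl I0 _; ring.
- by move=> x; apply: cl I0 _; ring.
- by move=> x y z; apply: cl I0 _; ring.
have [s sE] : {s : {rmorphism k -> quot_ring X} |
    forall x, s x = qpi (kalg_str A x : X)}.
  apply: kalg_of_setoid => [x y|x y|].
  - by rewrite rmorphD; exact: sr_refl.
  - by rewrite rmorphM; exact: sr_refl.
  - by rewrite rmorph1; exact: sr_refl.
have [p pE] := @khom_of A (KAlg s) (fun a => qpi (a : X)) (@qpiD X) (@qpiM X)
  (fun c => esym (sE c)).
exists (KAlg s), p; split=> [q|a].
  by exists (qrepr q); rewrite pE qreprK.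
by rewrite pE qpi_eq0 /= subr0.
Qed.

Lemma khom_factor A Q B (p : khom A Q) (h : khom A B) :
  (forall q, exists a, p a = q) -> (forall a, p a = 0 -> h a = 0) ->
  exists u : khom Q B, khom_comp u p = h.
Proof.
move=> /choice [r rK] ker.
(* The section [r] is a mere choice of lifts, but two lifts differ by an element of the kernel, so
   [h \o r] does not depend on it and is a morphism. *)
have hr a : h (r (p a)) = h a.
  apply/eqP; rewrite -subr_eq0 -rmorphB; apply/eqP/ker.
  by rewrite rmorphB rK subrr.
have [| | |u uE] := @khom_of Q B (fun q => h (r q)).
- by move=> x y; rewrite -rmorphD -[RHS]hr rmorphD !rK.
- by move=> x y; rewrite -rmorphM -[RHS]hr rmorphM !rK.
- by move=> c; rewrite -(khom_str p) hr khom_str.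
by exists u; apply: khom_ext => a /=; rewrite uE hr.
Qed.

Lemma localization_exists A (f : A) :
  exists (L : kalg k) (l : khom A L), is_localization f l.
Proof.
(* The pair [(a, n)] stands for [a / f ^+ n]; the factor [f ^+ N] is there because [f] may be a zero
   divisor. *)
pose E (x y : A * nat) :=
  exists N, f ^+ N * (x.1 * f ^+ y.2) = f ^+ N * (y.1 * f ^+ x.2).
have EI x y : x.1 * f ^+ y.2 = y.1 * f ^+ x.2 -> E x y.
  by move=> xy; exists 0; rewrite xy.
unshelve epose (X := @SetoidRing (A * nat)%type E (0, 0) (1, 0)
  (fun x => (- x.1, x.2))
  (fun x y => (x.1 * f ^+ y.2 + y.1 * f ^+ x.2, (x.2 + y.2)%N))
  (fun x y => (x.1 * y.1, (x.2 + y.2)%N))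
  _ _ _ _ _ _ _ _ _ _ _ _ _ _).
all: cbv beta.
- by move=> x; exact: EI.
- by move=> x y [N xy]; exists N.
(* Transitivity multiplies through by the denominator [f ^+ n] of the middle fraction, hence the
   extra exponent. *)
- move=> [x m] [y n] [z p] [N /= xy] [M /= yz]; exists (N + M + n)%N => /=.
  rewrite !exprD.
  transitivity ((f ^+ N * (x * f ^+ n)) * f ^+ M * f ^+ p); first by ring.
  rewrite xy.
  transitivity ((f ^+ M * (y * f ^+ p)) * f ^+ N * f ^+ m); first by ring.
  by rewrite yz; ring.
- move=> [x m] [y n] [N /= xy]; exists N => /=.
  by rewrite !mulNr !mulrN xy.
- move=> [x m] [y n] [z p] [N /= xy]; exists N => /=; rewrite !exprD.
  transitivity ((f ^+ N * (x * f ^+ n)) * f ^+ p * f ^+ p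
      + f ^+ N * z * f ^+ m * f ^+ n * f ^+ p); first by ring.
  by rewrite xy; ring.
- move=> [x m] [y n] [z p] [N /= xy]; exists N => /=; rewrite !exprD.
  transitivity ((f ^+ N * (x * f ^+ n)) * z * f ^+ p); first by ring.
  by rewrite xy; ring.
- by move=> [x m] [y n] [z p]; apply: EI => /=; rewrite !exprD; ring.
- by move=> [x m] [y n]; apply: EI => /=; rewrite !exprD; ring.
- by move=> [x m]; apply: EI => /=; rewrite ?exprD ?add0n; ring.
- by move=> [x m]; apply: EI => /=; rewrite !exprD; ring.
- by move=> [x m] [y n] [z p]; apply: EI => /=; rewrite !exprD; ring.
- by move=> [x m] [y n]; apply: EI => /=; rewrite !exprD; ring.
- by move=> [x m]; apply: EI => /=; rewrite ?add0n; ring.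
- by move=> [x m] [y n] [z p]; apply: EI => /=; rewrite !exprD; ring.
pose c (a : A) : X := (a, 0%N).
have cD a b : sr_eq (c (a + b)) (sr_add (c a) (c b)).
  by apply: (EI _ _) => /=; rewrite ?addn0; ring.
have cM a b : sr_eq (c (a * b)) (sr_mul (c a) (c b)).
  by apply: (EI _ _) => /=; rewrite ?addn0; ring.
have [s sE] : {s : {rmorphism k -> quot_ring X} |
    forall x, s x = qpi (c (kalg_str A x))}.
  apply: kalg_of_setoid => [x y|x y|].
  - by rewrite rmorphD; exact: cD.
  - by rewrite rmorphM; exact: cM.
  - by rewrite rmorph1; exact: sr_refl.
have [| |l lE] := @khom_of A (KAlg s) (fun a => qpi (c a)) _ _
  (fun c => esym (sE c)).
- by move=> a b /=; rewrite -qpiD; apply/qpiP.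
- by move=> a b /=; rewrite -qpiM; apply/qpiP.
have lX n : l f ^+ n = qpi (c (f ^+ n)) by rewrite -rmorphXn lE.
exists (KAlg s), l; split.
- exists (qpi ((1, 1%N) : X)); rewrite lE -qpiM -qpi1; apply/qpiP/EI => /=.
  by ring.
- move=> a; rewrite lE qpi_eq0 => -[N /=] aN; exists N.
  by move: aN; rewrite !expr0 !mulr1 mulr0.
- move=> b; exists (qrepr b).2, (qrepr b).1.
  rewrite lX lE -{1}(qreprK b) -qpiM; apply/qpiP/EI => /=.
  by rewrite addn0 expr0 mulr1.
Qed.
End AlgebraConstructions.

(** * Maximal submodules and residue fields *)

Section MaximalSubmodule.
Variables (R D : comPzRingType) (phi : {rmorphism R -> D}).

Definition is_submodule (W : D -> Prop) : Prop :=
  [/\ W 0, forall x y, W x -> W y -> W (x + y)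
    & forall r x, W x -> W (phi r * x)].

(** Zorn's lemma among the submodules containing [W0] and missing [d]. For [R = D] and [d = 1] it
    yields a maximal ideal; for [R = k], a hyperplane complementary to the line spanned by [d]. *)
Lemma maximal_submodule (W0 : D -> Prop) (d : D) :
  is_submodule W0 -> ~ W0 d ->
  exists W : D -> Prop,
    [/\ is_submodule W, forall x, W0 x -> W x, ~ W d
      & forall x, ~ W x -> exists r, W (d - phi r * x)].
Proof.
move=> [W00 W0D W0M] W0d.
(* The condition bears on the union with [W0], so that it also holds for the union of the empty
   chain. *)
pose P (X : set D) := is_submodule (X `|` W0)%classic /\ ~ (X `|` W0)%classic d.
have [F FP Ftot|X [[Xsub Xd] Xmax]] := @Zorn_bigcup D P.
  split.
    split; first by right.
    - move=> x y [[X FX Xx]|W0x] [[Y FY Yy]|W0y].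
      + have [XY|YX] := Ftot X Y FX FY.
        * have [[_ YD _] _] := FP Y FY.
          have [| |?|?] := YD x y;
            [by left; exact: XY|by left|by left; exists Y|by right].
        * have [[_ XD _] _] := FP X FX.
          have [| |?|?] := XD x y;
            [by left|by left; exact: YX|by left; exists X|by right].
      + have [[_ XD _] _] := FP X FX.
        have [| |?|?] := XD x y; [by left|by right|by left; exists X|by right].
      + have [[_ YD _] _] := FP Y FY.
        have [| |?|?] := YD x y; [by right|by left|by left; exists Y|by right].
      + by right; exact: W0D.
    - move=> r x [[X FX Xx]|W0x]; last by right; exact: W0M.
      have [[_ _ XM] _] := FP X FX.
      have [|?|?] := XM r x; [by left|by left; exists X|by right].
  by move=> [[X FX Xd]|//]; have [_] := FP X FX; apply; left.
have [W0' WD WM] := Xsub.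
exists (X `|` W0)%classic; split=> // [x W0x|x Wx]; first by right.
apply: contrapT => /forallNP nW.
(* If no multiple of [x] is congruent to [d] modulo [W], then [W + R x] is a strictly larger
   submodule still missing [d]. *)
pose Y :=
  [set y | exists r w, (X `|` W0)%classic w /\ y = w + phi r * x]%classic.
have WY y : (X `|` W0)%classic y -> Y y.
  by move=> Wy; exists 0, y; rewrite rmorph0 mul0r addr0.
have YW0 : (Y `|` W0)%classic = Y.
  apply/seteqP; split=> y Yy; last by left.
  by case: Yy => // W0y; apply: WY; right.
apply: (Xmax Y).
  split=> [y Xy|YX]; first by apply: WY; left.
  by apply: Wx; left; apply: YX; exists 1, 0; rewrite rmorph1 mul1r add0r.
rewrite /P YW0; split; first split.
- exact: WY.
- move=> _ _ [r [w [Ww ->]]] [r' [w' [Ww' ->]]].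
  by exists (r + r'), (w + w'); split; [exact: WD|rewrite rmorphD; ring].
- move=> r _ [r' [w' [Ww' ->]]].
  by exists (r * r'), (phi r * w'); split; [exact: WM|rewrite rmorphM; ring].
- by move=> [r [w [Ww dE]]]; apply: (nW r); rewrite dE addrK.
Qed.
End MaximalSubmodule.

(** Divide by a maximal ideal [W] containing [I]: for [a] outside [W], some [1 - r * a] lies in [W],
    so the class of [r] inverts that of [a]. *)
Lemma maximal_ideal_residue_field (k : fieldType) (A : kalg k)
    (I : A -> Prop) :
  is_ideal I -> ~ I 1 ->
  exists (K : kalg k) (p : khom A K),
    is_field_alg K /\ forall a, I a -> p a = 0.
Proof.
move=> Ii I1.
have [W [Wi IW W1 Wmax]] := @maximal_submodule A A idfun I 1 Ii I1.
have [K [p [psurj pker]]] := quotient_exists (Wi : is_ideal W).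
exists K, p; split; last by move=> a Ia; apply/pker/IW.
split; first by rewrite -(rmorph1 p) => /pker.
move=> x; have [a <-] := psurj x => pa0.
have [|r] := Wmax a; first by move=> /pker.
move=> /pker; rewrite rmorphB rmorph1 rmorphM => /eqP.
by rewrite subr_eq0 => /eqP pr; exists (p r); rewrite mulrC.
Qed.

(** * Linear forms and tensor products of [k]-algebras *)

Section LinearForms.
Variable k : fieldType.
Implicit Types A B D : kalg k.

Definition linear_form D (v : D -> k) : Prop :=
  {morph v : x y / x + y} /\ forall c x, v (kalg_str D c * x) = c * v x.

(** For a maximal [W], [D] is the direct sum of [W] and the line of [d], and [v x] is the coordinate
    of [x] along [d]. When [d - r x] is in [W] with [r] nonzero, this coordinate is [r^-1]. *)
Lemma linear_form_exists D (W0 : D -> Prop) (d : D) :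
  is_submodule (kalg_str D) W0 -> ~ W0 d ->
  exists v : D -> k, [/\ linear_form v, v d = 1 & forall x, W0 x -> v x = 0].
Proof.
move=> W0s W0d.
have [W [Wsub W0W Wd Wmax]] := maximal_submodule W0s W0d.
have [W_0 WD WM] := Wsub.
pose s := kalg_str D.
have ex x : exists c, W (x - s c * d).
  have [Wx|/Wmax[r Wr]] := pselect (W x).
    by exists 0; rewrite rmorph0 mul0r subr0.
  have [r0|r0] := eqVneq r 0.
    by case: Wd; move: Wr; rewrite r0 rmorph0 mul0r subr0.
  exists r^-1; move: (WM (- r^-1) _ Wr); congr W.
  rewrite mulrBr !rmorphN !mulNr mulrA -rmorphM mulVf // rmorph1; ring.
have uniq x c c' : W (x - s c * d) -> W (x - s c' * d) -> c = c'.
  move=> Wc Wc'; apply/eqP; apply: contrapT => /negP; rewrite -subr_eq0 => cc'.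
  apply: Wd; have := WD _ _ Wc' (WM (-1) _ Wc).
  move=> /(WM (c - c')^-1); congr W.
  transitivity (s ((c - c')^-1 * (c - c')) * d); last first.
    by rewrite mulVf // rmorph1 mul1r.
  by rewrite -/s !rmorphM rmorphN1 rmorphB; ring.
have [v vE] := choice ex.
exists v; split; first split.
- move=> x y; apply: uniq (vE _) _.
  by move: (WD _ _ (vE x) (vE y)); congr W; rewrite rmorphD; ring.
- move=> c x; apply: uniq (vE _) _.
  by move: (WM c _ (vE x)); congr W; rewrite -/s !rmorphM; ring.
- by apply: uniq (vE _) _; rewrite rmorph1 mul1r subrr.
- by move=> x /W0W Wx; apply: uniq (vE _) _; rewrite rmorph0 mul0r subr0.
Qed.

Lemma linear_form0 D (v : D -> k) : linear_form v -> v 0 = 0.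
Proof. by case=> _ vZ; rewrite -(mul0r 0) -(rmorph0 (kalg_str D)) vZ mul0r. Qed.

Lemma linear_formM D (v : D -> k) (d : D) :
  linear_form v -> linear_form (fun x => v (x * d)).
Proof.
by case=> vD vZ; split=> [x y|c x]; rewrite ?mulrDl ?vD // -mulrA vZ.
Qed.

Lemma linear_form_sum D (v : D -> k) n (c : nat -> k) (d : nat -> D) :
  linear_form v ->
  v (\sum_(i < n) kalg_str D (c i) * d i) = \sum_(i < n) c i * v (d i).
Proof.
move=> vl; have [vD vZ] := vl.
elim: n => [|n IH]; first by rewrite !big_ord0 linear_form0.
by rewrite !big_ord_recr /= vD IH vZ.
Qed.

(* If the last [d n] is a combination of the others it can be eliminated;
   otherwise some form is 1 on it and 0 on the others, so that [b n = 0]. *)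
Lemma linear_forms_separate_nat D B (g : khom D B) n
    (d : nat -> D) (b : nat -> B) :
  (forall v : D -> k, linear_form v ->
     \sum_(i < n) kalg_str B (v (d i)) * b i = 0) ->
  \sum_(i < n) g (d i) * b i = 0.
Proof.
elim: n b => [|n IH] b Hb; first by rewrite big_ord0.
pose W0 x := exists c : nat -> k, x = \sum_(i < n) kalg_str D (c i) * d i.
have [[c dn]|W0d] := pselect (W0 (d n)).
  rewrite big_ord_recr /= -[RHS](IH (fun i => b i + kalg_str B (c i) * b n)).
    rewrite dn rmorph_sum mulr_suml -big_split; apply: eq_bigr => i _ /=.
    by rewrite rmorphM khom_str; ring.
  move=> v vl; rewrite -[RHS](Hb v vl) big_ord_recr /= dn linear_form_sum //.
  rewrite rmorph_sum mulr_suml -big_split; apply: eq_bigr => i _ /=.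
  by rewrite rmorphM; ring.
have W0s : is_submodule (kalg_str D) W0.
  split.
  - by exists (fun=> 0); rewrite big1 // => i _; rewrite rmorph0 mul0r.
  - move=> _ _ [c ->] [c' ->]; exists (fun i => c i + c' i).
    by rewrite -big_split; apply: eq_bigr => i _; rewrite rmorphD mulrDl.
  - move=> r _ [c ->]; exists (fun i => r * c i).
    by rewrite mulr_sumr; apply: eq_bigr => i _; rewrite rmorphM mulrA.
have [v [vl vn v0]] := linear_form_exists W0s W0d.
have vi (i : 'I_n) : v (d i) = 0.
  apply: v0; exists (fun j => if j == i :> nat then 1 else 0).
  rewrite (bigD1 i) //= eqxx rmorph1 mul1r big1 ?addr0 // => j ji.
  by rewrite -val_eqE in ji; rewrite (negbTE ji) rmorph0 mul0r.
have bn : b n = 0.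
  move: (Hb v vl); rewrite big_ord_recr /= vn rmorph1 mul1r.
  rewrite big1 ?add0r // => i _.
  by rewrite vi rmorph0 mul0r.
rewrite big_ord_recr /= bn mulr0 addr0; apply: IH => w wl.
by move: (Hb w wl); rewrite big_ord_recr /= bn mulr0 addr0.
Qed.

(** A formal sum of tensors in [D (x) B] all of whose coordinates vanish is killed by the map
    [D (x) B -> B] induced by [g]. *)
Lemma linear_forms_separate D B (g : khom D B) (s : seq (D * B)) :
  (forall v : D -> k, linear_form v ->
     \sum_(p <- s) kalg_str B (v p.1) * p.2 = 0) ->
  \sum_(p <- s) g p.1 * p.2 = 0.
Proof.
move=> Hs; rewrite (big_nth (0, 0)) big_mkord.
apply: (@linear_forms_separate_nat D B g (size s)
  (fun i => (nth (0, 0) s i).1) (fun i => (nth (0, 0) s i).2)) => v vl.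
by rewrite -[RHS](Hs v vl) [RHS](big_nth (0, 0)) big_mkord.
Qed.

(* Formal sums are identified when all the maps [v (x) 1 : D (x) A -> A] agree
   on them; as [k] is a field, these maps are jointly injective. *)
Lemma tensor_exists D A :
  exists (T : kalg k) (i : khom D T) (j : khom A T),
    (forall x, exists s : seq (D * A), x = \sum_(p <- s) i p.1 * j p.2) /\
    forall s : seq (D * A), \sum_(p <- s) i p.1 * j p.2 = 0 ->
      forall v : D -> k, linear_form v ->
      \sum_(p <- s) kalg_str A (v p.1) * p.2 = 0.
Proof.
pose ev (v : D -> k) (s : seq (D * A)) :=
  \sum_(p <- s) kalg_str A (v p.1) * p.2.
pose E s t := forall v, linear_form v -> ev v s = ev v t.
pose mul (s t : seq (D * A)) := [seq (p.1 * q.1, p.2 * q.2) | p <- s, q <- t].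
have mulE s t v : ev v (mul s t) =
    \sum_(p <- s) \sum_(q <- t) kalg_str A (v (p.1 * q.1)) * (p.2 * q.2).
  by rewrite /ev big_allpairs_dep.
(* Each [x |-> v (x * q.1)] is again a linear form, so the coordinates of [s] determine those of
   [mul s t]: multiplication respects [E]. *)
have mulEr s t v :
    ev v (mul s t) = \sum_(q <- t) q.2 * ev (fun x => v (x * q.1)) s.
  rewrite mulE exchange_big; apply: eq_bigr => q _.
  by rewrite mulr_sumr; apply: eq_bigr => p _; ring.
have ev_cat v s t : ev v (s ++ t) = ev v s + ev v t by rewrite /ev big_cat.
have ev1 v d a : ev v [:: (d, a)] = kalg_str A (v d) * a.
  by rewrite /ev big_seq1.
unshelve epose (X := @SetoidRing (seq (D * A)) E [::] [:: (1, 1)]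
  (map (fun p => (p.1, - p.2))) cat mul
  _ _ _ _ _ _ _ _ _ _ _ _ _ _).
all: cbv beta.
- by [].
- by move=> s t st v vl; rewrite st.
- by move=> s t u st tu v vl; rewrite st ?tu.
- move=> s t st v vl; rewrite /ev !big_map /=; apply: oppr_inj.
  rewrite -!sumrN; under eq_bigr do rewrite mulrN opprK.
  by under [RHS]eq_bigr do rewrite mulrN opprK; exact: st.
- by move=> s t u st v vl; rewrite !ev_cat st.
- move=> s t u st v vl; rewrite !mulEr; apply: eq_bigr => q _.
  by rewrite st //; exact: linear_formM.
- by move=> s t u v vl; rewrite catA.
- by move=> s t v vl; rewrite !ev_cat addrC.
- by move=> s v vl.
- move=> s v vl; rewrite ev_cat /ev big_map -big_split big1 ?big_nil //= => p _.
  by rewrite mulrN addNr.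
- move=> s t u v vl; rewrite mulE [RHS]mulEr exchange_big big_allpairs_dep /=.
  rewrite /mul exchange_big; apply: eq_bigr => r _ /=.
  rewrite mulE mulr_sumr exchange_big; apply: eq_bigr => p _.
  rewrite mulr_sumr; apply: eq_bigr => q _.
  by rewrite !mulrA; ring.
- move=> s t v vl; rewrite !mulE exchange_big; apply: eq_bigr => q _.
  by apply: eq_bigr => p _; rewrite [p.1 * _]mulrC [p.2 * _]mulrC.
- move=> s v vl; rewrite mulE big_seq1; apply: eq_bigr => q _.
  by rewrite !mul1r.
- by move=> s t u v vl; rewrite ev_cat !mulE big_cat.
pose i0 (d : D) : X := [:: (d, 1)].
pose j0 (a : A) : X := [:: (1, a)].
have i0D x y : E (i0 (x + y)) (i0 x ++ i0 y).
  by move=> v [vD vZ]; rewrite ev_cat !ev1 vD rmorphD; ring.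
have i0M x y : E (i0 (x * y)) (mul (i0 x) (i0 y)).
  by move=> v vl; rewrite mulE !big_seq1 ev1 /= !mulr1.
have j0D x y : E (j0 (x + y)) (j0 x ++ j0 y).
  by move=> v vl; rewrite ev_cat !ev1; ring.
have j0M x y : E (j0 (x * y)) (mul (j0 x) (j0 y)).
  by move=> v vl; rewrite mulE !big_seq1 ev1 /= !mulr1.
have [c cE] : {c : {rmorphism k -> quot_ring X} |
    forall x, c x = qpi (i0 (kalg_str D x))}.
  apply: kalg_of_setoid => [x y|x y|] /=.
  - by rewrite rmorphD; exact: i0D.
  - by rewrite rmorphM; exact: i0M.
  - by rewrite rmorph1.
pose T := KAlg c.
have [| |i iE] := @khom_of _ D T (fun d => qpi (i0 d)) _ _
  (fun c => esym (cE c)).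
- by move=> x y /=; rewrite -qpiD; apply/qpiP/i0D.
- by move=> x y /=; rewrite -qpiM; apply/qpiP/i0M.
have [| | |j jE] := @khom_of _ A T (fun a => qpi (j0 a)).
- by move=> x y /=; rewrite -qpiD; apply/qpiP/j0D.
- by move=> x y /=; rewrite -qpiM; apply/qpiP/j0M.
- move=> x; rewrite /= cE; apply/qpiP => v [vD vZ] /=; rewrite !ev1.
  by rewrite -[kalg_str D x]mulr1 vZ rmorphM; ring.
(* A class is the sum of the pure tensors listed by any representative; both the spanning and the
   vanishing of coordinates follow. *)
have sumE (s : X) : \sum_(p <- (s : seq _)) i p.1 * j p.2 = qpi s.
  elim: s => [|p s IH]; first by rewrite big_nil -qpi0.
  rewrite big_cons IH iE jE -qpiM -qpiD; apply/qpiP => v vl /=.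
  rewrite -[p :: s]/([:: p] ++ s) !ev_cat /ev /mul /= big_seq1.
  by rewrite big_cons /= mulr1 mul1r.
exists T, i, j; split=> [x|s].
  by exists (qrepr x); rewrite sumE qreprK.
rewrite (sumE s) => /qpi_eq0 /= s0 v vl.
by rewrite -/(ev v s) s0 // /ev big_nil.
Qed.

(** The morphism is read off from any expression of an element as a sum of pure tensors. Two
    expressions of the same element differ by a sum with zero coordinates, which
    [linear_forms_separate] sends to 0 in [B]. *)
Lemma tensor_lift D A T B (i : khom D T) (j : khom A T)
    (g : khom D B) (h : khom A B) :
  (forall x, exists s : seq (D * A), x = \sum_(p <- s) i p.1 * j p.2) ->
  (forall s : seq (D * A), \sum_(p <- s) i p.1 * j p.2 = 0 ->
      forall v : D -> k, linear_form v ->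
      \sum_(p <- s) kalg_str A (v p.1) * p.2 = 0) ->
  exists t : khom T B, khom_comp t i = g /\ khom_comp t j = h.
Proof.
move=> span coord.
pose et (s : seq (D * A)) := \sum_(p <- s) i p.1 * j p.2.
pose eb (s : seq (D * A)) := \sum_(p <- s) g p.1 * h p.2.
pose opp (s : seq (D * A)) := [seq (p.1, - p.2) | p <- s].
pose mul (s t : seq (D * A)) := [seq (p.1 * q.1, p.2 * q.2) | p <- s, q <- t].
have eb0 s : et s = 0 -> eb s = 0.
  move=> /coord Hs.
  (* The coordinates over [B] are the images under [h] of those over [A]. *)
  have := @linear_forms_separate D B g [seq (p.1, h p.2) | p <- s].
  rewrite big_map; apply => v vl; rewrite big_map.
  transitivity (h (\sum_(p <- s) kalg_str A (v p.1) * p.2)).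
    by rewrite rmorph_sum; apply: eq_bigr => p _; rewrite rmorphM khom_str.
  by rewrite Hs // rmorph0.
have subE (R : comPzRingType) (a : {rmorphism D -> R}) (b : {rmorphism A -> R})
    s t : \sum_(p <- s ++ opp t) a p.1 * b p.2 =
      \sum_(p <- s) a p.1 * b p.2 - \sum_(p <- t) a p.1 * b p.2.
  rewrite big_cat big_map -sumrN; congr +%R.
  by apply: eq_bigr => p _; rewrite rmorphN mulrN.
have wd s t : et s = et t -> eb s = eb t.
  move=> st; apply/eqP; rewrite -subr_eq0 /eb -(subE _ g h); apply/eqP/eb0.
  by rewrite /et (subE _ i j) -/(et s) st subrr.
have [r rE] := choice span.
have [| | |t tE] := @khom_of _ T B (fun x => eb (r x)).
- move=> x y; rewrite -[RHS]big_cat; apply: wd.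
  by rewrite /et -rE big_cat /= -!rE.
- have mulE (R : comPzRingType) (a : {rmorphism D -> R})
      (b : {rmorphism A -> R}) s t :
      \sum_(p <- mul s t) a p.1 * b p.2 =
      (\sum_(p <- s) a p.1 * b p.2) * (\sum_(p <- t) a p.1 * b p.2).
    rewrite big_allpairs_dep big_distrlr; apply: eq_bigr => p _.
    by apply: eq_bigr => q _; rewrite /= !rmorphM; ring.
  move=> x y; rewrite -(mulE _ g h); apply: wd.
  by rewrite /et -rE (mulE _ i j) -!rE.
- move=> c; transitivity (eb [:: (kalg_str D c, 1)]).
    by apply: wd; rewrite /et -rE big_seq1 rmorph1 mulr1 khom_str.
  by rewrite /eb big_seq1 rmorph1 mulr1 khom_str.
exists t; split; apply: khom_ext => x /=; rewrite tE.
- transitivity (eb [:: (x, 1)]); last by rewrite /eb big_seq1 rmorph1 mulr1.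
  by apply: wd; rewrite /et -rE big_seq1 rmorph1 mulr1.
- transitivity (eb [:: (1, x)]); last by rewrite /eb big_seq1 rmorph1 mul1r.
  by apply: wd; rewrite /et -rE big_seq1 rmorph1 mul1r.
Qed.
End LinearForms.

(** * Local vanishing, affine charts and inverse images *)

(** These are the [f] for which [b] vanishes in [R[1/f]]; if 1 is among them then [b = 0]. In the
    expansion of [(f + g) ^+ (m + n)] every term contains [f ^+ m] or [g ^+ n]. *)
Lemma power_annihilator_ideal (R : comPzRingType) (b : R) :
  is_ideal (fun f : R => exists n : nat, f ^+ n * b = 0).
Proof.
split.
- by exists 1%N; rewrite expr1 mul0r.
- move=> f g [m fm] [n gn]; exists (m + n)%N.
  rewrite exprDn mulr_suml big1 // => i _.
  have [mi|im] := leqP n i.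
    have -> : g ^+ i = g ^+ (i - n) * g ^+ n by rewrite -exprD subnK.
    by rewrite mulrnAl -!mulrA gn !mulr0 mul0rn.
  have mi : (m <= m + n - i)%N by rewrite -addnBA ?leq_addr // ltnW.
  have -> : f ^+ (m + n - i) = f ^+ (m + n - i - m) * f ^+ m.
    by rewrite -exprD subnK.
  by rewrite mulrnAl [_ * g ^+ i]mulrC -!mulrA fm !mulr0 mul0rn.
- by move=> a f [n fn]; exists n; rewrite exprMn -mulrA fn mulr0.
Qed.

Section ClosedSubfunctors.
Variable k : fieldType.

Definition field_covering (X : kfunctor k) (J : Type) (U : J -> ksub X) :=
  forall K : kalg k, is_field_alg K -> forall x : X K, exists j, U j K x.

(** Otherwise the power annihilator of [b] is proper and dies in some field [K], where the image of
    [x] lies in some [U j]. For [f] in the ideal defining [U j], [x] lies in [U j] over [B[1/f]], so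
    [b] vanishes there and [f] dies in [K]; yet this ideal should generate 1 in [K]. *)
Lemma local_zero (X : kfunctor k) (J : Type) (U : J -> ksub X)
    (B : kalg k) (x : X B) (b : B) :
  (forall j, is_open_ksub (U j)) -> field_covering U ->
  (forall j (f : B) (L : kalg k) (l : khom B L), is_localization f l ->
     U j L (kmap X l x) -> l b = 0) ->
  b = 0.
Proof.
move=> Uopen Ucov locb; apply: contrapT => b0.
have [|K [p [Kfield pN]]] :=
    maximal_ideal_residue_field (power_annihilator_ideal b).
  by case=> n; rewrite expr1n mul1r.
have [j] := Ucov K Kfield (kmap X p x).
have [I [Ii UI]] := Uopen j B x.
rewrite UI => -[n [s [c [sI sum1]]]]; case: Kfield => K1 _; apply: K1.
rewrite -sum1 big1 // => i _; have [f [If <-]] := sI i.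
rewrite pN ?mulr0 //.
have [L [l lloc]] := localization_exists f; have [[u lfu] ker _] := lloc.
apply/ker/(locb j f L l lloc)/UI.
exists 1%N, (fun=> l f), (fun=> u); split; first by exists f.
by rewrite big_ord1 mulrC.
Qed.

(** Yoneda: an isomorphism with [Spec D] amounts to a universal point [u], the image of the identity
    of [D]. *)
Lemma affine_chartP (X : kfunctor k) (U : ksub X) (D : kalg k) :
  kiso (ksub_fun U) (Spec D) <->
  exists u : X D, U D u /\
    forall (B : kalg k) (x : X B), U B x ->
      exists! g : khom D B, kmap X g u = x.
Proof.
split=> [[phi [psi [psiK phiK]]]|[u [Uu uP]]].
  pose u := psi D (khom_id D).
  have uE (B : kalg k) (g : khom D B) : psi B g = kmap (ksub_fun U) g u.
    rewrite -kmor_nat; congr (psi B _); exact: khom_ext.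
  have psiKE B y : psi B (phi B y) = y.
    by have := congr1 (fun f => kmor_fun f B y) psiK.
  have phiKE B y : phi B (psi B y) = y.
    by have := congr1 (fun f => kmor_fun f B y) phiK.
  exists (sval u); split=> [|B x Ux]; first exact: svalP u.
  exists (phi B (exist _ x Ux)); split=> [|g gx].
    by rewrite -[LHS]/(sval (kmap (ksub_fun U) _ u)) -uE psiKE.
  rewrite -[RHS]phiKE; congr (phi B _); rewrite uE; exact: eq_exist.
have Ug (B : kalg k) (g : khom D B) : U B (kmap X g u) by exact: ksub_stable.
have c (B : kalg k) (x : ksub_fun U B) :
    {g : khom D B | kmap X g u = sval x /\
      forall g', kmap X g' u = sval x -> g = g'}.
  by apply: cid; have [g gP] := uP B _ (svalP x); exists g.
have phiN (A B : kalg k) (h : khom A B) (x : ksub_fun U A) :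
    sval (c B (kmap _ h x)) = khom_comp h (sval (c A x)).
  apply: (svalP (c B _)).2; rewrite kmap_comp.
  by rewrite (svalP (c A x)).1.
have psiN (A B : kalg k) (h : khom A B) (g : Spec D A) :
    exist (U B) (kmap X (khom_comp h g) u) (Ug B _) =
    kmap (ksub_fun U) h (exist (U A) (kmap X g u) (Ug A _)).
  by apply: eq_exist; rewrite kmap_comp.
exists (@KMor k (ksub_fun U) (Spec D) (fun B x => sval (c B x)) phiN).
exists (@KMor k (Spec D) (ksub_fun U) (fun B g => exist _ _ (Ug B g)) psiN).
split; apply: kmor_ext => B x /=.
- by case: x => x Ux; apply: eq_exist; rewrite (svalP (c B _)).1.
- exact: (svalP (c B _)).2.
Qed.

Definition kpre (X Y : kfunctor k) (m : kmor X Y) (U : ksub Y) : ksub X.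
Proof.
refine (@KSub k X (fun A x => U A (m A x)) _).
by move=> A B h x Ux; rewrite kmor_nat; exact: ksub_stable.
Defined.

Lemma kpre_closed (X Y : kfunctor k) (m : kmor X Y) (U : ksub Y) :
  is_closed_ksub U -> is_closed_ksub (kpre m U).
Proof.
move=> Uc A x; have [I [Ii UI]] := Uc A (m A x).
by exists I; split=> // B h; rewrite /= kmor_nat.
Qed.

Lemma kpre_open (X Y : kfunctor k) (m : kmor X Y) (U : ksub Y) :
  is_open_ksub U -> is_open_ksub (kpre m U).
Proof.
move=> Uo A x; have [I [Ii UI]] := Uo A (m A x).
by exists I; split=> // B h; rewrite /= kmor_nat.
Qed.

(** * Universal quantification over the points of [G] *)

(** The largest subfunctor [Q] of [Y] with [G x Q] inside [P]; quantifying over all extensions [B]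
    makes it stable under base change. *)
Definition kforall (G Y : kfunctor k) (P : ksub (kprod G Y)) : ksub Y.
Proof.
refine (@KSub k Y (fun A y => forall (B : kalg k) (h : khom A B) (g : G B),
  P B (g, kmap Y h y)) _).
by move=> A B h y Py C h' g; rewrite -kmap_comp; exact: Py.
Defined.

(* Freeness of D (x) A over A: the equations of P at the universal point of
   Spec D x Spec A have coordinates in the ideal I. *)
Lemma kforall_affine (G Y : kfunctor k) (P : ksub (kprod G Y))
    (D A B : kalg k) (u : G D) (y : Y A) (g : khom D B) (h : khom A B) :
  is_closed_ksub P ->
  (forall a : A, (forall (C : kalg k) (h' : khom A C),
      kforall P C (kmap Y h' y) -> h' a = 0) -> h a = 0) ->
  P B (kmap G g u, kmap Y h y).
Proof.
move=> Pc hI.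
have [T [i [j [span coord]]]] := tensor_exists D A.
have [t [ti tj]] := tensor_lift g h span coord.
have [J [_ PJ]] := Pc T (kmap G i u, kmap Y j y).
have := (PJ B t).2; rewrite /= -!kmap_comp ti tj; apply=> x Jx.
have [s xs] := span x.
rewrite xs rmorph_sum.
under eq_bigr => p _.
  rewrite rmorphM -[t (i _)]/(khom_comp t i _) ti.
  rewrite -[t (j _)]/(khom_comp t j _) tj; over.
have := @linear_forms_separate k D B g [seq (p.1, h p.2) | p <- s].
rewrite big_map; apply => v vl; rewrite big_map.
transitivity (h (\sum_(p <- s) kalg_str A (v p.1) * p.2)).
  by rewrite rmorph_sum; apply: eq_bigr => p _; rewrite rmorphM khom_str.
(* It remains to see that this coordinate of [x] dies in every [C] where the condition holds. There
   the universal point over [D (x) C] lies in [P], so the image of [x] in [D (x) C] is 0, and so are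
   its coordinates. *)
apply: hI => C h' Qh'.
have [T' [i' [j' [span' coord']]]] := tensor_exists D C.
have [t' [ti' tj']] := tensor_lift i' (khom_comp j' h') span coord.
have t'x : t' x = 0.
  apply: (PJ T' t').1 => //; rewrite /= -!kmap_comp ti' tj' kmap_comp.
  exact: Qh'.
have t's : \sum_(p <- [seq (p.1, h' p.2) | p <- s]) i' p.1 * j' p.2 = 0.
  rewrite big_map -[RHS]t'x xs rmorph_sum; apply: eq_bigr => p _.
  rewrite rmorphM -[t' (i _)]/(khom_comp t' i _) ti'.
  by rewrite -[t' (j _)]/(khom_comp t' j _) tj'.
rewrite -[RHS](coord' _ t's v vl) big_map rmorph_sum.
by apply: eq_bigr => p _; rewrite rmorphM khom_str.
Qed.

(** The ideal is the intersection of the kernels of all [A -> C] over which the condition holds.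
    That its zeros satisfy the condition is checked locally on the base of the point [g]. *)
Lemma kforall_closed (G Y : kfunctor k) (P : ksub (kprod G Y)) :
  has_affine_cover (fun=> True) G -> is_closed_ksub P ->
  is_closed_ksub (kforall P).
Proof.
move=> [J [U [Uopen Uaff Ucov]]] Pc A y.
exists (fun a => forall (C : kalg k) (h : khom A C),
  kforall P C (kmap Y h y) -> h a = 0); split.
  split=> [C h _|a b Ia Ib C h Qh|a b Ib C h Qh].
  - exact: rmorph0.
  - by rewrite rmorphD Ia ?Ib ?addr0.
  - by rewrite rmorphM Ib ?mulr0.
move=> B h; split=> [Qh a|hI]; first exact.
move=> C h' g; rewrite -kmap_comp; set h'' := khom_comp h' h.
have h''I a : (forall (C : kalg k) (h : khom A C),
    kforall P C (kmap Y h y) -> h a = 0) -> h'' a = 0.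
  by move=> /hI ha; rewrite /= ha rmorph0.
have [I [Ii PI]] := Pc C (g, kmap Y h'' y).
have := (PI C (khom_id C)).2; rewrite kmap_id; apply => b Ib /=.
(* Over the localization [L], [g] lies in a chart [Spec D] and is the pullback of its universal
   point, the case settled by [kforall_affine]. *)
apply: (local_zero Uopen Ucov (x := g)) => j f L l _ Ujg.
have [D [_ /affine_chartP [u [_ uP]]]] := Uaff j.
have [gam [gamu _]] := uP L _ Ujg.
apply: (PI L l).1 => //; rewrite /= -kmap_comp -gamu.
apply: kforall_affine => // a /h''I h''a.
by rewrite -[LHS]/(l (h'' a)) h''a rmorph0.
Qed.

(** * Closed subfunctors of schemes as closed subschemes *)

(** Glue in [X]; each equation [a] of [Z] at the glued point vanishes in every [A[1/f i]], so the
    power annihilator of [a] contains all [f i], hence 1. *)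
Lemma closed_zariski_sheaf (X : kfunctor k) (Z : ksub X) :
  is_closed_ksub Z -> is_zariski_sheaf X -> is_zariski_sheaf (ksub_fun Z).
Proof.
move=> Zc Xs A n f fcov L l lloc M m mloc p q pl ql x xpq.
have [y [yx yuniq]] := Xs A n f fcov L l lloc M m mloc p q pl ql
  (fun i => sval (x i)) (fun i j => congr1 sval (xpq i j)).
have Zy : Z A y.
  have [I [Ii ZI]] := Zc A y.
  have := (ZI A (khom_id A)).2; rewrite kmap_id; apply => a Ia /=.
  have [c csum] := fcov.
  have [N0 ND NM] := power_annihilator_ideal a.
  suff [r] : exists r : nat, 1 ^+ r * a = 0 by rewrite expr1n mul1r.
  rewrite -csum; elim/big_ind: _ => // i _; apply: NM.
  have [_ ker _] := lloc i; apply: ker; apply: (ZI _ (l i)).1 Ia.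
  by rewrite yx; exact: svalP.
exists (exist _ y Zy); split=> [i|[z Zz] zx].
  by move: (yx i); case: (x i) => w Zw /= yw; exact: eq_exist.
apply: eq_exist; apply: yuniq => i; exact: (congr1 sval (zx i)).
Qed.

Definition kincl (X : kfunctor k) (Z : ksub X) : kmor (ksub_fun Z) X :=
  @KMor k (ksub_fun Z) X (fun _ z => sval z) (fun _ _ _ _ => erefl).

(** A chart [Spec D] of [X] meets [Z] in [Spec (D / I)], where [I] is the ideal of [Z] at the
    universal point. The parameter [Pr] covers both plain affine covers and those of finite type. *)
Lemma closed_affine_cover (Pr : kalg k -> Prop) (X : kfunctor k) (Z : ksub X) :
  (forall (A Q : kalg k) (p : khom A Q),
     (forall q, exists a, p a = q) -> Pr A -> Pr Q) ->
  is_closed_ksub Z -> has_affine_cover Pr X -> has_affine_cover Pr (ksub_fun Z).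
Proof.
move=> PrQ Zc [J [U [Uopen Uaff Ucov]]].
exists J, (fun j => kpre (kincl Z) (U j)); split=> [j|j|K Kf x].
- exact: kpre_open.
- have [D [PrD /affine_chartP [u [Uu uP]]]] := Uaff j.
  have [I [Ii ZI]] := Zc D u.
  have [Q [p [psurj pker]]] := quotient_exists Ii.
  exists Q; split; first exact: PrQ PrD.
  have Zu : Z Q (kmap X p u) by apply/ZI => a /pker.
  apply/affine_chartP; exists (exist _ _ Zu); split; first exact: ksub_stable.
  move=> B [x Zx] /= Ux; have [g [gx guniq]] := uP B x Ux.
  have [|t tp] := @khom_factor k D Q B p g psurj.
    by move=> a /pker; apply: (ZI B g).1; rewrite gx.
  exists t; split=> [|t' tx].
    by apply: eq_exist; rewrite /= -kmap_comp tp.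
  have t'p : khom_comp t' p = g.
    by symmetry; apply: guniq; rewrite kmap_comp; exact: (congr1 sval tx).
  apply: khom_ext => q; have [a <-] := psurj q.
  by rewrite -[LHS]/(khom_comp t p a) -[RHS]/(khom_comp t' p a) tp t'p.
- exact: Ucov.
Qed.

Lemma fin_gen_alg_quotient (A Q : kalg k) (p : khom A Q) :
  (forall q, exists a, p a = q) -> fin_gen_alg A -> fin_gen_alg Q.
Proof.
move=> psurj [n [x xgen]]; exists n, (fun i => p (x i)) => P Pk Px PD PM q.
have [a <-] := psurj q; apply: (xgen (fun a => P (p a))) => [c|//|b c|b c].
- by rewrite khom_str.
- by rewrite rmorphD; exact: PD.
- by rewrite rmorphM; exact: PM.
Qed.

Lemma closed_separated (X : kfunctor k) (Z : ksub X) :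
  separated X -> separated (ksub_fun Z).
Proof.
move=> Xs A [z w]; have [I [Ii XI]] := Xs A (sval z, sval w).
exists I; split=> // B h; rewrite -XI /=.
split=> [zw|zw]; first exact: (congr1 sval zw).
exact: eq_exist.
Qed.

Lemma closed_subscheme (S : scheme k) (Z : ksub S) : is_closed_ksub Z ->
  exists (T : scheme k) (i : kmor T S), closed_immersion i /\
    forall (W : scheme k) (t : kmor W S),
      (forall A w, Z A (t A w)) <-> exists! u : kmor W T, kmor_comp i u = t.
Proof.
move=> Zc; have [Ssheaf Saff] := scheme_is_kscheme S.
have Tk : is_kscheme (ksub_fun Z).
  by split; [exact: closed_zariski_sheaf|exact: closed_affine_cover].
have Tlft : locally_of_finite_type (ksub_fun Z).
  apply: closed_affine_cover (scheme_lft S) => //; exact: fin_gen_alg_quotient.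
pose T := Scheme Tk Tlft (closed_separated (@scheme_sep k S)).
have iinj (A : kalg k) : injective (fun z : T A => kincl Z A z).
  by move=> [x Zx] [y Zy] xy; exact: eq_exist.
exists T, (kincl Z); split.
  split=> // A x; have [I [Ii ZI]] := Zc A x; exists I; split=> // B h.
  by rewrite -ZI; split=> [[z <-]|Zx]; [exact: svalP|exists (exist _ _ Zx)].
move=> W t; split=> [Zt|[u [<- _]] A w]; last exact: svalP (u A w).
have uN (A B : kalg k) (h : khom A B) (w : W A) :
    exist (Z B) (t B (kmap W h w)) (Zt B _) =
    kmap (ksub_fun Z) h (exist (Z A) (t A w) (Zt A w)).
  by apply: eq_exist; rewrite kmor_nat.
exists (@KMor k W T (fun A w => exist _ _ (Zt A w)) uN).
split=> [|u' tu']; first exact: kmor_ext.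
apply: kmor_ext => A w; apply: iinj; rewrite /=.
by rewrite -tu'.
Qed.
End ClosedSubfunctors.

(** * The closed locus over which a family of morphisms is multiplicative *)

Theorem lemma2p8 (k : fieldType) (G H : group_scheme k) :
  is_closed_subfunctor (Hom_gp G H).
Proof.
(* By Yoneda, [phi] is determined by the single family [f], and [phi T t] is its pullback along
   [t]. *)
move=> S phi; pose f : kmor (kprod G S) H := phi S (kmor_id S).
have phiE (T : scheme k) (t : kmor T S) : phi T t = kmor_comp f (id_prod G t).
  have := sn_nat phi t (kmor_id S); rewrite /= => <-.
  by congr (phi T _); exact: kmor_ext.
have dN (A B : kalg k) (h : khom A B) (p : kprod G (kprod G S) A) :
    (f B (gs_mul G B (kmap G h p.1, kmap G h p.2.1), kmap S h p.2.2),
     gs_mul H B (f B (kmap G h p.1, kmap S h p.2.2),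
                 f B (kmap G h p.2.1, kmap S h p.2.2))) =
    kmap (kprod H H) h (f A (gs_mul G A (p.1, p.2.1), p.2.2),
      gs_mul H A (f A (p.1, p.2.2), f A (p.2.1, p.2.2))).
  by rewrite /= -!kmor_nat /= -!kmor_nat.
pose d := @KMor k (kprod G (kprod G S)) (kprod H H) (fun A p =>
  (f A (gs_mul G A (p.1, p.2.1), p.2.2),
   gs_mul H A (f A (p.1, p.2.2), f A (p.2.1, p.2.2)))) dN.
(* The inner quantifier binds [g1], the outer one [g2]. *)
pose Z := kforall (kforall (kpre d (kdiag H))).
have [_ Gaff] := scheme_is_kscheme G.
have Zc : is_closed_ksub Z.
  apply: kforall_closed => //; apply: kforall_closed => //.
  exact: kpre_closed (@scheme_sep k H).
have [T [i [iclosed iP]]] := closed_subscheme Zc.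
exists T, i; split=> // W t; rewrite -iP /= phiE.
split=> [tgp A w|Zt A g1 g2 w].
- move=> B h g2 C h' g1 /=; rewrite -!kmor_nat.
  exact: tgp.
- by have := Zt A w A (khom_id A) g2 A (khom_id A) g1; rewrite /= !kmap_id.
Qed.
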